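(* (i) $G(A)\cap G(B)$ is a free group on $2$ generators and an index $2$ subgroup of $G(B)$. (ii) For any $n\ge1$, $G(A^{(n)})\cap G(B^{(n)})$ is a free group on $2n$ generators and an index $2$ subgroup of $G(B^{(n)})$. (iii) For any nonempty finite set $N$ of positive integers, $G(A^{(N)})\cap G(B^{(N)})$ is an index $2$ subgroup of $G(B^{(N)})$. Also, $G(A^{(N)})\cap G(B^{(N)})$ is a free group of rank less by $1$ than the free rank of the free group $G(A^{(N)})$.
   Context: An automaton is a quadruple $(Q,X,\phi,\psi)$ with nonempty sets $Q$ (internal states) and $X$ (finite alphabet), a state transition function $\phi:Q\times X\to Q$ and an output function $\psi:Q\times X\to X$. Let $X^*$ be the set of finite words over $X$ (including the empty word). For an automaton $Y=(Q,X,\phi,\psi)$ and $q\in Q$, the transformation $Y_q:X^*\to X^*$ is defined recursively by $Y_q(\varnothing)=\varnothing$ and $Y_q(xw)=\psi(q,x)\,Y_{\phi(q,x)}(w)$ for $x\in X$, $w\in X^*$. $Y$ is invertible if all $Y_q$, $q\in Q$, are bijective; then $G(Y)$ is the group of transformations of $X^*$ generated (under composition) by $Y_q$, $q\in Q$. Intersections are taken inside the group of all bijections of $\{0,1\}^*$. For $n\ge1$ let $Q_1=\{a_1,b_1,c_1\}$ and $Q_n=\{a_n,b_n,c_n,q_{n1},\dots,q_{n,2n-2}\}$ for $n\ge2$ ($2n+1$ elements); the sets $Q_n$ are pairwise disjoint. With $q_{n0}:=c_n$ and $q_{n,2n-1}:=a_n$, define $\phi_n:Q_n\times\{0,1\}\to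 Q_n$ by $\phi_n(a_n,0)=\phi_n(b_n,1)=c_n$, $\phi_n(a_n,1)=\phi_n(b_n,0)=b_n$, and $\phi_n(q_{ni},0)=\phi_n(q_{ni},1)=q_{n,i+1}$ for $0\le i\le 2n-2$. The Aleshin type automaton is $A^{(n)}=(Q_n,\{0,1\},\phi_n,\psi_n)$, where $\psi_n(q,x)=1-x$ if $q\in\{a_n,b_n\}$ and $\psi_n(q,x)=x$ otherwise. The Bellaterra type automaton is $B^{(n)}=(Q_n,\{0,1\},\phi_n,\widehat\psi_n)$, where $\widehat\psi_n(q,x)=1-\psi_n(q,x)$. The Aleshin automaton $A$ and the Bellaterra automaton $B$ are $A^{(1)}$ and $B^{(1)}$ with states $a_1,b_1,c_1$ renamed $a,b,c$. All these automata are invertible. The disjoint union of finitely many automata over the same alphabet with pairwise disjoint state sets is the automaton whose state set is the union of the state sets and whose transition and output functions restrict to those of each component. $A^{(N)}$ and $B^{(N)}$ are the disjoint unions of $A^{(n)}$, $n\in N$, and of $B^{(n)}$, $n\in N$, respectively. It is known that $G(A^{(N)})$ is a free group. *)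

(* Defs.v *)
From HB Require Import structures.
From mathcomp Require Import all_boot.
From mathcomp Require Import finmap.
From mathcomp Require Import boolp classical_sets functions cardinality.

Set Implicit Arguments.
Unset Strict Implicit.
Unset Printing Implicit Defensive.

Local Open Scope classical_set_scope.

Record bijection (T : Type) := Bijection {
  bij_fun :> T -> T;
  bij_inv : T -> T;
  bij_funK : cancel bij_fun bij_inv;
  bij_invK : cancel bij_inv bij_fun }.

Lemma bijection_eq (T : Type) (g h : bijection T) : g =1 h -> g = h.
Proof.
case: g h => [g g' gK g'K] [h h' hK h'K] /= /funext egh.
rewrite {}egh in gK g'K *.
have eg' : g' = h' by apply/funext => x; rewrite -{1}(h'K x) gK.
rewrite {}eg' in gK g'K *.
by congr Bijection; apply: Prop_irrelevance.
Qed.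

Section BijectionGroup.
Variable T : Type.
Implicit Types g h : bijection T.

Definition bij_one := @Bijection T id id (fun=> erefl) (fun=> erefl).

Definition bij_mul g h :=
  @Bijection T (g \o h) (bij_inv h \o bij_inv g)
    (can_comp (bij_funK g) (bij_funK h)) (can_comp (bij_invK h) (bij_invK g)).

Definition bij_inverse g := Bijection (bij_invK g) (bij_funK g).

Lemma bij_mulA : associative bij_mul.
Proof. by move=> g h k; apply: bijection_eq. Qed.

Lemma bij_mul1 : left_id bij_one bij_mul.
Proof. by move=> g; apply: bijection_eq. Qed.

Lemma bij_mulr1 : right_id bij_one bij_mul.
Proof. by move=> g; apply: bijection_eq. Qed.

Lemma bij_mulV : left_inverse bij_one bij_inverse bij_mul.
Proof. by move=> g; apply: bijection_eq => x /=; rewrite bij_funK. Qed.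

Lemma bij_mulrV : right_inverse bij_one bij_inverse bij_mul.
Proof. by move=> g; apply: bijection_eq => x /=; rewrite bij_invK. Qed.

HB.instance Definition _ := gen_eqMixin (bijection T).
HB.instance Definition _ := gen_choiceMixin (bijection T).
HB.instance Definition _ := isGroup.Build (bijection T)
  bij_mulA bij_mul1 bij_mulr1 bij_mulV bij_mulrV.

End BijectionGroup.

Section Subgroups.
Local Open Scope group_scope.
Variable gT : groupType.
Implicit Types (H K S : set gT).

Definition subgroup H :=
  [/\ H 1, (forall x y, H x -> H y -> H (x * y)) & forall x, H x -> H x^-1].

Definition generated S : set gT := smallest subgroup S.

Definition left_cosets H K : set (set gT) :=
  [set C | exists2 g, K g & C = [set g * h | h in H]].

Definition subgroup_of_index (k : nat) H K :=
  [/\ subgroup H, H `<=` K & (left_cosets H K #= `I_k)%card].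

(* The letter (i, true) stands for the i-th generator, (i, false) for its
   inverse. *)
Definition reduced k (w : seq ('I_k * bool)) :=
  sorted [rel u v | v != (u.1, ~~ u.2)] w.

Definition word_value k (s : 'I_k -> gT) (w : seq ('I_k * bool)) : gT :=
  \prod_(u <- w) (if u.2 then s u.1 else (s u.1)^-1).

Definition free_basis k (s : 'I_k -> gT) H :=
  (forall i, H (s i)) /\
  forall x, H x -> exists! w, reduced w /\ word_value s w = x.

Definition free_of_rank (k : nat) H :=
  subgroup H /\ exists s : 'I_k -> gT, free_basis s H.

End Subgroups.

Record automaton (X : finType) := Automaton {
  state : Type;
  trans : state -> X -> state;
  out : state -> X -> X }.

Section Automata.
Variable X : finType.
Implicit Type Y : automaton X.

Fixpoint transf Y (q : state Y) (w : seq X) : seq X :=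
  if w is x :: w' then out q x :: transf (trans q x) w' else [::].

Definition invertible Y := forall q : state Y, bijective (transf q).

Definition automaton_group Y : set (bijection (seq X)) :=
  generated [set g | exists q : state Y, bij_fun g = transf q].

Definition disjoint_union (I : finType) (Y : I -> automaton X) : automaton X :=
  {| state := {i : I & state (Y i)};
     trans q x := Tagged (fun i => state (Y i)) (trans (tagged q) x);
     out q x := out (tagged q) x |}.

Lemma out_bij_invertible Y :
  (forall q : state Y, injective (out q)) -> invertible Y.
Proof.
move=> outI; pose inv q := invF (outI q).
pose fix g (q : state Y) w :=
  if w is y :: w' then inv q y :: g (trans q (inv q y)) w' else [::].
move=> q; exists (g q).
- by move=> w; elim: w q => //= x w IHw q; rewrite /inv invF_f IHw.
- by move=> w; elim: w q => //= x w IHw q; rewrite /inv f_invF IHw.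
Qed.

End Automata.

(* [st_q j] is the state q_{n,j+1}, for 0 <= j < 2n - 2. *)
Inductive aleshin_state (n : nat) :=
  | st_a | st_b | st_c | st_q of 'I_(2 * n - 2).

Arguments st_a {n}.
Arguments st_b {n}.
Arguments st_c {n}.

(* The state q_{ni} for 0 <= i <= 2n - 1, with q_{n0} = c_n and
   q_{n,2n-1} = a_n. *)
Definition q_state n (i : nat) : aleshin_state n :=
  if i is j.+1 then
    if insub j is Some j' then st_q j' else st_a
  else st_c.

(* The letters 0 and 1 are [false] and [true]. *)
Definition aleshin_trans n (q : aleshin_state n) (x : bool) :
    aleshin_state n :=
  match q with
  | st_a => if x then st_b else st_c
  | st_b => if x then st_c else st_b
  | st_c => q_state n 1
  | st_q j => q_state n j.+2
  end.

Definition aleshin_out n (q : aleshin_state n) (x : bool) : bool :=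
  match q with
  | st_a | st_b => ~~ x
  | _ => x
  end.

Definition aleshin_type n : automaton bool :=
  Automaton (@aleshin_trans n) (@aleshin_out n).

Definition bellaterra_type n : automaton bool :=
  Automaton (@aleshin_trans n) (fun q x => ~~ aleshin_out q x).

Definition aleshin : automaton bool := aleshin_type 1.
Definition bellaterra : automaton bool := bellaterra_type 1.

Definition aleshin_union (N : {fset nat}) : automaton bool :=
  disjoint_union (fun n : N => aleshin_type (val n)).

Definition bellaterra_union (N : {fset nat}) : automaton bool :=
  disjoint_union (fun n : N => bellaterra_type (val n)).

Lemma aleshin_out_inj n (q : aleshin_state n) : injective (aleshin_out q).
Proof. by case: q => [|||?] [] []. Qed.

Lemma bellaterra_out_inj n (q : aleshin_state n) :
  injective (fun x => ~~ aleshin_out q x).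
Proof. by move=> x y /negb_inj/aleshin_out_inj. Qed.

Lemma aleshin_type_invertible n : invertible (aleshin_type n).
Proof. by apply: out_bij_invertible => q; apply: aleshin_out_inj. Qed.

Lemma bellaterra_type_invertible n : invertible (bellaterra_type n).
Proof. by apply: out_bij_invertible => q; apply: bellaterra_out_inj. Qed.

Lemma aleshin_union_invertible N : invertible (aleshin_union N).
Proof. by apply: out_bij_invertible => q; apply: aleshin_out_inj. Qed.

Lemma bellaterra_union_invertible N : invertible (bellaterra_union N).
Proof. by apply: out_bij_invertible => q; apply: bellaterra_out_inj. Qed.

(* Since 2 * n - 2 is truncated, the transitions are checked against their
   definition for n >= 1. *)
Lemma q_state_last n : 0 < n -> q_state n (2 * n - 1) = st_a.
Proof.
case: n => // n _; rewrite mulnS -addnBAC //= /q_state.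
by rewrite insubF // mulnS addKn ltnn.
Qed.

Lemma q_state_trans n i x : 0 < n -> i <= 2 * n - 2 ->
  aleshin_trans (q_state n i) x = q_state n i.+1.
Proof.
case: i => [|i] // n_gt0 lt_i.
by rewrite {1}/q_state insubT.
Qed.

(* Main.v *)
From mathcomp Require Import fingroup perm.
Require Import Defs.
From mathcomp Require Import all_boot.
From mathcomp Require Import finmap.
From mathcomp Require Import boolp classical_sets functions cardinality.

(* Write s for the flip of all digits, so that A_q = s B_q with B_q and s of
   order 2.  Everything follows once s and the B_q, over all states q of all the
   automata, are known to be free generators of a free product of groups of
   order 2: the products s B_q = A_q are then free, the intersection consists of
   the products of an even number of the B_q, and it is freely generated by the
   B_p B_q with p fixed and q <> p.

   To prove freeness, let the two states of the dual automaton generate a group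
   H acting on words in the letters s and q.  Relations B_v = B_x are preserved
   by H, so it suffices that the stabilizer in H of a word v without equal
   adjacent letters induces all permutations of the states of each automaton
   other than the first letter of v: a relation B_v = B_x would then give
   B_x = B_y with x <> y.  This is shown by induction on the length of v: if u is
   a word with the same pattern (the automata its letters belong to) as v, and
   an element of H fixes u and all its extensions by one letter while inducing a
   transposition on first letters, then by normality such elements induce all
   permutations.  Words u of this kind can be written down explicitly, with
   letters a_n, b_n, c_n and s, for v or for its reversal. *)

Set Implicit Arguments.
Unset Strict Implicit.
Unset Printing Implicit Defensive.

Local Open Scope classical_set_scope.

Notation alternating := (sorted [rel x y | x != y]).

(** * Generated subgroups *)

Section GeneratedSubgroups.
Local Open Scope group_scope.
Variable gT : groupType.
Implicit Types (S K : set gT).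

Lemma subgroup_generated S : subgroup (generated S).
Proof.
split=> [K [[]]//|x y gx gy K SK|x gx K SK]; have [[K1 KM KV] _] := SK.
- by apply: KM; [apply: gx | apply: gy].
- by apply: KV; apply: gx.
Qed.

Lemma generated_ind S K : subgroup K -> S `<=` K -> generated S `<=` K.
Proof. exact: smallest_sub. Qed.

Lemma subgroup_expg K x m : subgroup K -> K x -> K (x ^+ m).
Proof.
by move=> [K1 KM _] Kx; elim: m => [|m IHm]; rewrite ?expg0 // expgS; apply: KM.
Qed.

End GeneratedSubgroups.

(** * The group generated by the dual automaton *)

Section DualAutomaton.
Local Open Scope group_scope.

(* There is one family of states for each [i : I]: the state [None] stands for
   b_n and [Some m] for the m-th iterate of c_n along the cycle
   c_n -> q_{n1} -> ... -> q_{n,2n-2} -> a_n -> c_n, where [k i = 2n - 2].  The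
   extra letter [None] stands for the transformation that flips every digit. *)
Variables (I : finType) (k : I -> nat).

Definition cstate (i : I) := option 'I_(k i).+2.
Definition letter := option {i : I & cstate i}.

Definition lett i (z : cstate i) : letter := Some (Tagged cstate z).

Definition pat (l : letter) : option I := omap tag l.

Definition lmap (f : forall i, {perm cstate i}) (l : letter) : letter :=
  if l is Some q then lett (f (tag q) (tagged q)) else None.

Lemma lmapK f : cancel (lmap f) (lmap (fun i => (f i)^-1)).
Proof. by case=> [[i z]|] //; rewrite /lmap /lett /= permK. Qed.

Lemma lmapKV f : cancel (lmap (fun i => (f i)^-1)) (lmap f).
Proof. by case=> [[i z]|] //; rewrite /lmap /lett /= permKV. Qed.

Lemma lmap_inj f : injective (lmap f).
Proof. exact: can_inj (lmapK f). Qed.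

Lemma lmapM f g l : lmap (fun i => f i * g i) l = lmap g (lmap f l).
Proof. by case: l => [[i z]|] //; rewrite /lmap /lett /= permM. Qed.

Lemma pat_lmap f l : pat (lmap f l) = pat l.
Proof. by case: l => [[]|]. Qed.

Lemma lett_inj i : injective (@lett i).
Proof. by move=> x y /eqP; rewrite /lett (inj_eq Some_inj) eq_Tagged => /eqP. Qed.

Definition cyc i m : cstate i := Some (inord (m %% (k i).+2)).

Lemma cyc_modn i m : cyc i (m %% (k i).+2) = cyc i m.
Proof. by rewrite /cyc modn_mod. Qed.

Lemma eq_cyc i m m' : (cyc i m == cyc i m') = (m == m' %[mod (k i).+2])%N.
Proof.
rewrite /cyc (inj_eq Some_inj); apply/eqP/eqP => [/(congr1 (@nat_of_ord _))|->//].
by rewrite !inordK ?ltn_mod.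
Qed.

Lemma cycP i (z : cstate i) : z = None \/ exists m, z = cyc i m.
Proof.
case: z => [j|]; [right; exists j | by left].
by rewrite /cyc modn_small // inord_val.
Qed.

Definition swp i : {perm cstate i} := tperm None (cyc i 0).

Lemma rot_inj i : injective (omap (@ordS (k i).+2)).
Proof. exact: inj_omap (@ordS_inj _). Qed.

Definition rot i : {perm cstate i} := perm (@rot_inj i).

Lemma rotNone i : rot i None = None.
Proof. by rewrite permE. Qed.

Lemma rot_cyc i m : rot i (cyc i m) = cyc i m.+1.
Proof.
rewrite permE /=; congr Some; apply: val_inj => /=.
by rewrite !inordK ?ltn_mod // -addn1 modnDml addn1.
Qed.

(** * The gate, a two-state transducer on words of letters *)

Definition toggles (l : letter) : bool :=
  if l is Some q then tagged q \notin [:: None; cyc (tag q) 0] else true.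

Arguments toggles : simpl never.

(** In state [true] the gate swaps b_n and c_n; all other letters pass unchanged and reverse the
    state. Preceded by [rot], it is the dual of the Bellaterra automata together with the flip. *)
Fixpoint gate (e : bool) (w : seq letter) : seq letter :=
  if w is l :: w' then
    (if e then lmap swp l else l) :: gate (e (+) toggles l) w'
  else [::].

Definition gate_end (e : bool) (w : seq letter) : bool :=
  foldl (fun e l => e (+) toggles l) e w.

Lemma toggles_lett i (z : cstate i) :
  toggles (lett z) = (z \notin [:: None; cyc i 0]).
Proof. by []. Qed.

Lemma toggles_lmap f l :
  (forall i, f i \in [:: swp i; 1]) \/
  (forall i, f i None = None /\ f i (cyc i 0) = cyc i 0) ->
  toggles (lmap f l) = toggles l.
Proof.
case: l => [[i z]|] // [/(_ i)|/(_ i)[f1 f2]]; rewrite /lmap !toggles_lett /= !inE.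
  case/orP => /eqP ->; last by rewrite perm1.
  rewrite /swp; case: tpermP => [->|->|_ _] //; rewrite ?eqxx //.
by rewrite -[in LHS]f1 -[in LHS]f2 !(inj_eq perm_inj).
Qed.

Lemma toggles_swp l : toggles (lmap swp l) = toggles l.
Proof. by apply: toggles_lmap; left=> i; rewrite inE eqxx. Qed.

Lemma toggles_fix l : toggles l -> lmap swp l = l.
Proof.
case: l => [[i z]|] //; rewrite toggles_lett !inE negb_or => /andP[z1 z2].
by rewrite /lmap /= tpermD // eq_sym.
Qed.

Lemma lmap_swpK : involutive (lmap swp).
Proof. by case=> [[i z]|] //; rewrite /lmap /lett /= tpermK. Qed.

Lemma gateK e : involutive (gate e).
Proof.
move=> w; elim: w e => //= l w IHw e.
by case: e; rewrite ?toggles_swp ?lmap_swpK IHw.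
Qed.

Lemma gate_cat e u w : gate e (u ++ w) = gate e u ++ gate (gate_end e u) w.
Proof. by elim: u e => //= l u IHu e; rewrite IHu. Qed.

Lemma gate_end_cat e u w :
  gate_end e (u ++ w) = gate_end (gate_end e u) w.
Proof. exact: foldl_cat. Qed.

(** The states before and after a letter differ only if it toggles, and then [swp] fixes it; so each
    letter may be read with either state. *)
Lemma gate_rev e w :
  gate (gate_end e w) (rev w) = rev (gate e w) /\
  gate_end (gate_end e w) (rev w) = e.
Proof.
elim: w e => //= l w IHw e; have [IH1 IH2] := IHw (e (+) toggles l).
rewrite !rev_cons -!cats1 gate_cat gate_end_cat IH1 IH2; split; last first.
  by rewrite /= addbK.
congr cat => /=; case: (boolP (toggles l)) => t; last by rewrite addbF.
by rewrite toggles_fix // !if_same.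
Qed.

Lemma gate_true w : gate true w = map (lmap swp) (gate false w).
Proof.
suff gateC e : gate (~~ e) w = map (lmap swp) (gate e w) by rewrite -gateC.
elim: w e => //= l w IHw e; rewrite -IHw addNb; congr cons.
by case: e; rewrite ?lmap_swpK.
Qed.

Lemma gate_lmap (f : forall i, {perm cstate i}) e w :
  (forall i, f i None = None /\ f i (cyc i 0) = cyc i 0) \/ (f = swp) ->
  gate e (map (lmap f) w) = map (lmap f) (gate e w).
Proof.
move=> f12; have tf l : toggles (lmap f l) = toggles l.
  by case: f12 => [f12|->]; [apply: toggles_lmap; right | apply: toggles_swp].
have fs l : lmap swp (lmap f l) = lmap f (lmap swp l).
  case: f12 => [f12|-> //]; case: l => [[i z]|] //; rewrite /lmap /=.
  have [f1 f2] := f12 i; have sf : swp i ^ f i = swp i by rewrite /swp tpermJ f1 f2.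
  by rewrite -!permM -{1}sf conjgE !mulgA mulgV mul1g.
elim: w e => //= l w IHw e.
by rewrite tf IHw fs; case: e.
Qed.

(** * The group of the dual automaton *)

Definition gateb e : bijection (seq letter) := Bijection (gateK e) (gateK e).

Definition lmapb (f : forall i, {perm cstate i}) : bijection (seq letter) :=
  Bijection (mapK (lmapK f)) (mapK (lmapKV f)).

Definition dual e : bijection (seq letter) := gateb e * lmapb rot.

Definition dualG : set (bijection (seq letter)) :=
  generated [set g | exists e, g = dual e].

Definition dual_end e w := gate_end e (map (lmap rot) w).

Lemma dualG1 : dualG 1.
Proof. by have [] := subgroup_generated [set g | exists e, g = dual e]. Qed.

Lemma dualGM g h : dualG g -> dualG h -> dualG (g * h).
Proof. by have [_ + _] := subgroup_generated [set g | exists e, g = dual e]; apply. Qed.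

Lemma dualGV g : dualG g -> dualG g^-1.
Proof. by have [_ _] := subgroup_generated [set g | exists e, g = dual e]; apply. Qed.

Lemma dualG_dual e : dualG (dual e).
Proof. by apply: sub_gen_smallest; exists e. Qed.

(** Bijections compose from right to left but permutations from left to right, so the factors trade
    places. *)
Lemma lmapbM f g : lmapb f * lmapb g = lmapb (fun i => g i * f i).
Proof.
apply: bijection_eq => w /=; rewrite -map_comp.
by apply: eq_map => l /=; rewrite lmapM.
Qed.

Lemma lmapbV f : (lmapb f)^-1 = lmapb (fun i => (f i)^-1).
Proof. exact: bijection_eq. Qed.

Lemma eq_lmapb f g : (forall i, f i = g i) -> lmapb f = lmapb g.
Proof.
by move=> fg; apply: bijection_eq => w; apply: eq_map => -[[i z]|] //; rewrite /lmap /= fg.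
Qed.

Lemma lmapbX f m : lmapb f ^+ m = lmapb (fun i => f i ^+ m).
Proof.
elim: m => [|m IHm]; last by rewrite expgSr IHm lmapbM; apply: eq_lmapb => i; rewrite expgS.
rewrite expg0; apply: bijection_eq => w /=.
by rewrite -[LHS]map_id; apply: eq_map => -[[i z]|] //; rewrite /lmap /= expg0 perm1.
Qed.

(** By [gate_true] the two dual states differ by exactly this letterwise swap. *)
Lemma dualG_swp : dualG (lmapb swp).
Proof.
have -> : lmapb swp = dual true * (dual false)^-1.
  rewrite /dual invgM mulgA mulgK.
  have gv : (gateb false)^-1 = gateb false by apply: bijection_eq.
  by rewrite gv; apply: bijection_eq => w /=; rewrite gate_true gateK.
by apply: dualGM; last apply: dualGV; apply: dualG_dual.
Qed.

(* [rotF i] cycles through a_n, q_{n1}, ..., q_{n,2n-2} and fixes b_n and c_n. *)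
Definition rotF i : {perm cstate i} := tperm (cyc i (k i).+1) (cyc i 0) * rot i.

Lemma rot_last i : rot i (cyc i (k i).+1) = cyc i 0.
Proof. by rewrite rot_cyc -cyc_modn modnn. Qed.

Lemma cyc_last_neq0 i : cyc i (k i).+1 != cyc i 0.
Proof. by rewrite eq_cyc mod0n modn_small. Qed.

Lemma rotF_None i : rotF i None = None.
Proof. by rewrite permM tpermD // rotNone. Qed.

Lemma rotF_cyc0 i : rotF i (cyc i 0) = cyc i 0.
Proof. by rewrite permM tpermR rot_last. Qed.

Lemma rotF_cyc i m : m < (k i).+1 ->
  rotF i (cyc i m.+1) = cyc i (m.+1 %% (k i).+1).+1.
Proof.
rewrite ltnS leq_eqVlt permM => /orP[/eqP->|lt_m].
  by rewrite tpermL rot_cyc modnn.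
have lt_m1 : m.+1 < (k i).+2 by rewrite ltnS ltnW.
rewrite tpermD ?rot_cyc ?modn_small // eq_cyc ?mod0n !modn_small //.
by rewrite eqSS eq_sym neq_ltn lt_m.
Qed.

Lemma rotFX i m j : m < (k i).+1 ->
  (rotF i ^+ j) (cyc i m.+1) = cyc i ((m + j) %% (k i).+1).+1.
Proof.
move=> lt_m; elim: j => [|j IHj]; first by rewrite expg0 perm1 addn0 modn_small.
rewrite expgSr permM IHj rotF_cyc ?ltn_mod //.
by congr (cyc _ _.+1); rewrite -addn1 modnDml addn1 addnS.
Qed.

Lemma rotFX1 i j : (k i).+1 %| j -> rotF i ^+ j = 1.
Proof.
move=> dv_j; apply/perm.permP => z; rewrite perm1.
have fixX y : rotF i y = y -> (rotF i ^+ j) y = y.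
  by move=> fy; elim: j {dv_j} => [|j IHj]; rewrite ?perm1 // expgS permM fy.
have [->|[m ->]] := cycP z; first exact/fixX/rotF_None.
rewrite -cyc_modn; case: (m %% _) (ltn_pmod m (ltn0Sn (k i).+1)) => [|m'] lt_m.
  exact/fixX/rotF_cyc0.
rewrite rotFX //; congr (cyc _ _.+1).
by rewrite -modnDmr (eqP dv_j) addn0 modn_small.
Qed.

(* Up to a letterwise permutation in the group, [dual false] is the product of
   [gateb false], of order 2, and of a commuting letterwise permutation, whose
   order is odd as it only has cycles of odd length 1 or 2n - 1. *)
Lemma dualG_gate : (forall i, ~~ odd (k i)) -> dualG (gateb false).
Proof.
move=> k_even.
(* Swapping a_n and c_n before [rot] gives [rotF]. This swap is obtained from [swp] by two
   conjugations: by [dual false], giving the swap [ta] of b_n and a_n, then by [ta]. *)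
pose tc i := tperm (cyc i (k i).+1) (cyc i 0).
have tcG : dualG (lmapb tc).
  pose ta i := tperm None (cyc i (k i).+1).
  have taG : dualG (lmapb ta).
    have -> : lmapb ta = (dual false)^-1 * (lmapb (@swp) * dual false).
      have gC : gateb false * lmapb swp = lmapb swp * gateb false.
        by apply: bijection_eq => w /=; rewrite gate_lmap //; right.
      rewrite /dual invgM -!mulgA (mulgA (lmapb swp)) -gC -mulgA mulKg.
      rewrite lmapbV !lmapbM; apply: eq_lmapb => i.
      rewrite -[RHS]mulgA -{1}[rot i]invgK -conjgE tpermJ /ta.
      by congr tperm; apply/(@perm_inj _ (rot i)); rewrite permKV ?rotNone ?rot_last.
    by apply: dualGM (dualGV (dualG_dual _)) (dualGM dualG_swp (dualG_dual _)).
  have -> : lmapb tc = lmapb ta * (lmapb swp * lmapb ta).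
    rewrite !lmapbM; apply: eq_lmapb => i.
    rewrite -[RHS]mulgA -{1}[ta i]tpermV -conjgE tpermJ tpermL.
    by rewrite tpermD // cyc_last_neq0.
  exact: dualGM taG (dualGM dualG_swp taG).
(* An odd common multiple of the cycle lengths of all the [rotF i]: this power kills [rotF] but not
   the gate. *)
pose M := (\prod_i (k i).+1)%N.
have M_odd : odd M.
  by apply: (big_ind (fun m => odd m)) => // [x y|i _]; rewrite ?oddM /= ?k_even // => -> ->.
suff <- : (dual false * lmapb tc) ^+ M = gateb false.
  exact: subgroup_expg (subgroup_generated _) (dualGM (dualG_dual _) tcG).
have -> : dual false * lmapb tc = gateb false * lmapb rotF.
  by rewrite -mulgA lmapbM.
rewrite expgMn; last first.
  apply: bijection_eq => w /=; rewrite gate_lmap //; left=> i.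
  by rewrite rotF_None rotF_cyc0.
have -> : gateb false ^+ M = gateb false.
  rewrite -(odd_double_half M) M_odd expgD expg1 -mul2n expgM.
  have -> : gateb false ^+ 2 = 1 by apply: bijection_eq => w; exact: gateK.
  by rewrite expg1n mulg1.
rewrite lmapbX (@eq_lmapb _ (fun=> 1)); last first.
  by move=> i; apply: rotFX1; rewrite /M (bigD1 i) //= dvdn_mulr.
by rewrite -(lmapbX (fun=> 1) 0) expg0 mulg1.
Qed.

Lemma dualG_gateb e : (forall i, ~~ odd (k i)) -> dualG (gateb e).
Proof.
move=> k_even; case: e; last exact: dualG_gate.
have -> : gateb true = lmapb swp * gateb false.
  by apply: bijection_eq => w /=; rewrite gate_true.
exact: dualGM dualG_swp (dualG_gate k_even).
Qed.

Lemma bij_mulE (T : Type) (g h : bijection T) w : (g * h) w = g (h w).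
Proof. by []. Qed.

Lemma bij_VK (T : Type) (g : bijection T) w : g^-1 (g w) = w.
Proof. exact: (bij_funK g). Qed.

Lemma bij_KV (T : Type) (g : bijection T) w : g (g^-1 w) = w.
Proof. exact: (bij_invK g). Qed.

Lemma bij_conjE (T : Type) (g h : bijection T) w : (g * h * g^-1) (g w) = g (h w).
Proof. by rewrite !bij_mulE bij_VK. Qed.

Lemma dualG_ind (P : set (bijection (seq letter))) :
    P 1 -> (forall g h, P g -> P h -> P (g * h)) -> (forall g, P g -> P g^-1) ->
    (forall e, P (dual e)) ->
  forall h, dualG h -> P h.
Proof. by move=> P1 PM PV Pd; apply: generated_ind => // _ [e ->]. Qed.

Lemma dualG_pat h w : dualG h -> map pat (h w) = map pat w.
Proof.
move=> Hh; move: h Hh w; apply: dualG_ind => [|g h IHg IHh|g IHg|e] w //.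
- by rewrite bij_mulE IHg.
- by rewrite -[in RHS](bij_KV g w) IHg.
have patG e' u : map pat (gate e' u) = map pat u.
  elim: u e' => //= l u IHu e'; rewrite IHu; congr cons.
  by case: e'; rewrite ?pat_lmap.
by rewrite /= patG -map_comp; apply: eq_map => l /=; rewrite pat_lmap.
Qed.

Lemma dualG_size h w : dualG h -> size (h w) = size w.
Proof. by move=> Hh; rewrite -(size_map pat) dualG_pat // size_map. Qed.

Lemma dualG_letter h : dualG h ->
  exists f, forall l, h [:: l] = [:: lmap f l].
Proof.
move: h; apply: dualG_ind => [|g h [f gf] [f' hf']|g [f gf]|e].
- by exists (fun=> 1) => -[[i z]|] //; rewrite /lmap /= perm1.
- by exists (fun i => f' i * f i) => l; rewrite bij_mulE hf' gf lmapM.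
- by exists (fun i => (f i)^-1) => l; rewrite -[l in LHS](lmapKV f) -gf bij_VK.
- exists (fun i => if e then rot i * swp i else rot i) => l /=.
  by case: e; case: l => [[i z]|] //; rewrite /lmap /= permM.
Qed.

(* The dual automaton is reversible, so the group acts on the Cayley tree of
   the free product of the groups of order 2 generated by the letters; moving
   the root of the tree from the beginning to the end of [v] turns [h] into [h']. *)
Lemma dualG_rev h v : dualG h -> exists h',
  [/\ dualG h', forall w, h (v ++ w) = h v ++ h' w &
      forall u, h' (rev v ++ u) = rev (h v) ++ h u].
Proof.
move=> Hh; move: h Hh v; apply: dualG_ind => [|g h IHg IHh|g IHg|e] v.
- by exists 1; split=> //; apply: dualG1.
- have [h' [Hh' h1 h2]] := IHh v; have [g' [Hg' g1 g2]] := IHg (h v).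
  exists (g' * h'); split=> [|w|u]; first exact: dualGM.
    by rewrite bij_mulE h1 g1.
  by rewrite bij_mulE h2 g2.
- have [g' [Hg' g1 g2]] := IHg (g^-1 v).
  exists g'^-1; split=> [|w|u]; first exact: dualGV.
    by rewrite -{1}(bij_KV g v) -{1}(bij_KV g' w) -g1 bij_VK.
  by rewrite -{1}(bij_KV g v) -{1}(bij_KV g u) -g2 bij_VK.
- exists (dual (dual_end e v)); split=> [|w|u]; first exact: dualG_dual.
    by rewrite /= map_cat gate_cat.
  have [r1 r2] := gate_rev e (map (lmap rot) v).
  by rewrite /dual_end /= map_cat map_rev gate_cat r1 r2.
Qed.

(** * Stabilizers of words and their action on first letters *)

Definition letter_action (v : seq letter) i (s : {perm cstate i}) :=
  exists h, [/\ dualG h, h v = v & forall z, h [:: lett z] = [:: lett (s z)]].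

Lemma letter_action1 v i : letter_action v (1 : {perm cstate i}).
Proof. by exists 1; split=> [||z]; rewrite ?perm1 //; apply: dualG1. Qed.

Lemma letter_actionM v i (s t : {perm cstate i}) :
  letter_action v s -> letter_action v t -> letter_action v (s * t).
Proof.
move=> [g [Hg gv gs]] [h [Hh hv ht]]; exists (h * g); split=> [||z].
- exact: dualGM.
- by rewrite bij_mulE gv hv.
- by rewrite bij_mulE gs ht permM.
Qed.

Lemma letter_actionV v i (s : {perm cstate i}) :
  letter_action v s -> letter_action v s^-1.
Proof.
move=> [g [Hg gv gs]]; exists g^-1; split=> [||z]; first exact: dualGV.
  by rewrite -{1}gv bij_VK.
by rewrite -{1}[z](permKV s) -gs bij_VK.
Qed.

Lemma letter_actionJ v i (s t : {perm cstate i}) :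
  letter_action v s -> letter_action v t -> letter_action v (s ^ t).
Proof.
move=> As At; rewrite conjgE.
exact: letter_actionM (letter_actionV At) (letter_actionM As At).
Qed.

Lemma letter_action_transport h f u v i (s : {perm cstate i}) :
    dualG h -> (forall l, h [:: l] = [:: lmap f l]) -> h u = v ->
  letter_action u s -> letter_action v (s ^ f i).
Proof.
move=> Hh hf huv [g [Hg gu gs]]; exists (h * g * h^-1); split=> [||z].
- by apply: dualGM (dualGV Hh); apply: dualGM.
- by rewrite !bij_mulE -{1}huv bij_VK gu.
- have -> : lett z = lmap f (lett ((f i)^-1 z)) by rewrite /lmap /= permKV.
  by rewrite !bij_mulE -hf bij_VK gs hf conjgE !permM.
Qed.

(** In the tree picture, the stabilizer of the path [v] permutes the neighbours of the root. It
    fixes the one on [v], which is therefore excluded. *)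
Definition full (v : seq letter) := forall i (x y : cstate i),
  ohead v != Some (lett x) -> ohead v != Some (lett y) ->
  letter_action v (tperm x y).

Lemma star_tperm v i :
  (forall m, letter_action v (tperm None (cyc i m))) ->
  forall x y : cstate i, letter_action v (tperm x y).
Proof.
move=> star.
have starN (y : cstate i) : letter_action v (tperm None y).
  by have [->|[m ->]] := cycP y; [rewrite tperm1; apply: letter_action1|].
move=> x y; have [->|xy] := eqVneq x y; first by rewrite tperm1; apply: letter_action1.
have [->|x0] := eqVneq x None; first exact: starN.
have [->|y0] := eqVneq y None; first by rewrite tpermC; apply: starN.
have := letter_actionJ (starN x) (starN y).
by rewrite tpermJ tpermL tpermD // 1?eq_sym // tpermC.
Qed.

(** Start from [swp] and conjugate [m] times by [dual false], which acts on single letters as [rot]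
    and fixes b_n. One [m] serves all families, whose cycle lengths may differ. *)
Lemma dualG_star m : exists h, dualG h /\
  forall i (z : cstate i), h [:: lett z] = [:: lett (tperm None (cyc i m) z)].
Proof.
elim: m => [|m [h [Hh hm]]]; first by exists (lmapb swp); split; first exact: dualG_swp.
have dl i (z : cstate i) : dual false [:: lett z] = [:: lett (rot i z)] by [].
exists (dual false * h * (dual false)^-1); split=> [|i z].
  by apply: dualGM (dualGV _); [apply: dualGM => //|]; apply: dualG_dual.
rewrite -[z](permKV (rot i)) -dl bij_conjE hm dl.
by rewrite -[in RHS]rot_cyc -[in RHS](rotNone i) -tpermJ conjgE !permM permK.
Qed.

Lemma full_nil : full [::].
Proof.
move=> i x y _ _; apply: star_tperm => m; have [h [Hh hm]] := dualG_star m.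
by exists h; split=> //; apply/size0nil; rewrite dualG_size.
Qed.

Definition transitive_on n := forall u v,
  size u = n -> map pat u = map pat v ->
  alternating u -> alternating v ->
  exists2 h, dualG h & h u = v.

Lemma pat_lett (l : letter) i : pat l = Some i -> exists z, l = lett (z : cstate i).
Proof. by case: l => [[j z]|] //= [<-]; exists z. Qed.

Lemma ohead_path (l : letter) v :
  path [rel x y | x != y] l v = (ohead v != Some l) && alternating v.
Proof. by case: v => //= y v; rewrite inj_eq 1?eq_sym //; apply: Some_inj. Qed.

(** Match the tails first. With the root moved across the first letter, the element sends [l :: u]
    to some [lmap f l :: v], and fullness of [v] corrects that first letter. *)
Lemma transitive_onS n :
    transitive_on n ->
    (forall v, size v = n -> alternating v -> full v) ->
  transitive_on n.+1.
Proof.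
move=> trn fulln [|l u] [|l' v] //= [szu] [pl pv].
rewrite !ohead_path => /andP[hu su] /andP[hv sv].
have [h Hh huv] := trn _ _ szu pv su sv.
have [f hf] := dualG_letter Hh.
have [h' [Hh' h1 h2]] := dualG_rev [:: l] Hh.
have h'u : h' (l :: u) = lmap f l :: v by rewrite (h2 u) hf huv.
have szv : size v = n by rewrite -(size_map pat) -pv size_map.
case: l' pl hv => [[i z']|] /= pl hv; last first.
  by exists h' => //; rewrite h'u; case: (l) pl.
have [z lz] := pat_lett pl.
have hfl : ohead v != Some (lmap f l).
  rewrite -huv; case: (u) hu => [|l1 u1]; first by rewrite (size0nil (dualG_size [::] Hh)).
  have [h1' [_ h1'1 _]] := dualG_rev [:: l1] Hh.
  rewrite -[l1 :: u1]cat1s h1'1 hf /= => /eqP l1l; apply/eqP => -[/lmap_inj].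
  by move=> ?; subst l1.
have := fulln v szv sv i (f i z) z'; rewrite lz in hfl *.
case=> // g [Hg gv gz].
have [g' [Hg' _ g2]] := dualG_rev [:: lett (f i z)] Hg.
exists (g' * h'); first exact: dualGM.
by rewrite bij_mulE -lz h'u lz (g2 v) gv gz tpermL.
Qed.

Lemma dualG_ohead h f u : dualG h -> (forall l, h [:: l] = [:: lmap f l]) ->
  ohead (h u) = omap (lmap f) (ohead u).
Proof.
move=> Hh hf; case: u => [|l u]; first by rewrite (size0nil (dualG_size [::] Hh)).
have [h' [_ h1 _]] := dualG_rev [:: l] Hh.
by rewrite -[l :: u]cat1s h1 hf.
Qed.

(** Elements of [dualG_star] act on all families at once, with periods [(k i).+2] that are distinct
    by injectivity of [k]. This separates family [t] from family [i]. *)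
Lemma full_cyc0 i t : injective k -> i != t ->
  forall x y : cstate t, letter_action [:: lett (cyc i 0)] (tperm x y).
Proof.
move=> k_inj it; apply: star_tperm => m.
pose v := [:: lett (cyc i 0)].
have star m' : ~~ ((k i).+2 %| m') -> letter_action v (tperm None (cyc t m')).
  move=> m'i; have [h [Hh hm]] := dualG_star m'; exists h; split=> //.
  by rewrite hm tpermD // eq_cyc mod0n.
(* When the index is a multiple of the period of [i], the element swaps b_i and c_i; two such
   elements together restore c_i. *)
have star2 m1 m2 : (k i).+2 %| m1 -> (k i).+2 %| m2 ->
    letter_action v (tperm None (cyc t m1) * tperm None (cyc t m2)).
  move=> d1 d2; have [h1 [Hh1 h1m]] := dualG_star m1; have [h2 [Hh2 h2m]] := dualG_star m2.
  have c0 m0 : (k i).+2 %| m0 -> cyc i m0 = cyc i 0.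
    by move=> d0; apply/eqP; rewrite eq_cyc mod0n.
  exists (h2 * h1); split=> [||z]; first exact: dualGM.
    by rewrite bij_mulE h1m h2m !c0 // tpermR tpermL.
  by rewrite bij_mulE h1m h2m permM.
have [dm|/star//] := boolP ((k i).+2 %| m).
(* If the period of [t] is not a multiple of that of [i], adding it to [m] keeps the transposition
   in [t] but makes the element fix c_i. *)
have [dt|ndt] := boolP ((k i).+2 %| (k t).+2); last first.
  have <- : cyc t (m + (k t).+2) = cyc t m by apply/eqP; rewrite eq_cyc modnDr.
  by apply: star; rewrite dvdn_addr.
have lt_it : (k i).+2 < (k t).+2.
  rewrite ltn_neqAle dvdn_leq // andbT !eqSS.
  by apply: contra it => /eqP/k_inj ->.
have m_m' : cyc t m != cyc t (m + (k i).+2).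
  rewrite eq_cyc -{1}[m]addn0 eqn_modDl mod0n modn_small //.
have c1 m' : (k i).+2 %| m' -> cyc t m' != cyc t 1.
  move=> dm'; rewrite eq_cyc; apply/eqP => /(congr1 (fun n => n %% (k i).+2)).
  by rewrite !modn_dvdm // (eqP dm') modn_small.
have A1 : letter_action v (tperm None (cyc t 1)) by apply: star; rewrite gtnNdvd.
have dm' : (k i).+2 %| m + (k i).+2 by rewrite dvdn_addr.
(* Conjugating the swap of b and [cyc t 1] by this product moves b to [cyc t m]; conjugating again
   by [A1] turns [cyc t 1] back into b. *)
have := letter_actionJ A1 (star2 _ _ dm dm').
rewrite tpermJ !permM tpermL !tpermD ?c1 // 1?eq_sym // => A1'.
have := letter_actionJ A1' A1.
by rewrite tpermJ tpermR tpermD // 1?eq_sym ?c1 // tpermC.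
Qed.

Lemma full_one l : injective k -> full [:: l].
Proof.
move=> k_inj t x y /=.
have nil i (x' y' : cstate i) : letter_action [::] (tperm x' y') by apply: full_nil.
case: l => [[i z]|] xz yz; last first.
  have [h [Hh _ hz]] := nil t x y; exists h; split=> //.
  by have [f ->] := dualG_letter Hh.
case: (eqVneq i t) => it.
  subst t; have [h [Hh _ hz]] := nil i x y; exists h; split=> //.
  rewrite (hz z) tpermD //; [move: xz|move: yz]; apply: contraNneq => ->; exact/eqP.
have [h [Hh _ hz]] := nil i (cyc i 0) z; have [f hf] := dualG_letter Hh.
have hc : h [:: lett (cyc i 0)] = [:: lett z] by rewrite hz tpermL.
have := letter_action_transport Hh hf hc
  (full_cyc0 k_inj it ((f t)^-1 x) ((f t)^-1 y)).
by rewrite tpermJ !permKV.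
Qed.

(* Letters c_n and b_n alternate as long as the gate is in the state [false],
   in which it fixes them; a letter a_n is placed where the state has to change. *)
Lemma gate_fixed_forward v (f b : bool) :
    alternating v -> ohead v != Some None -> (f -> v != [::]) ->
  exists u, [/\ map pat u = map pat v, alternating u, gate false u = u,
    gate_end false u = f &
    forall i, ohead u != Some (lett (if b then None else cyc i 0))].
Proof.
pose a i := cyc i (k i).+1; pose bc b' i : cstate i := if b' then cyc i 0 else None.
have aT i : toggles (lett (a i)).
  by rewrite toggles_lett !inE /= cyc_last_neq0.
have bcT b' i : toggles (lett (bc b' i)) = false.
  by rewrite toggles_lett /bc !inE; case: b'; rewrite eqxx ?orbT.
have a_bc b' i j : Some (lett (a i)) != Some (lett (bc b' j)).
  by rewrite (inj_eq Some_inj); apply: contraTneq (aT i) => ->; rewrite bcT.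
have bc_bc b' i j : Some (lett (bc b' i)) != Some (lett (bc (~~ b') j)).
  rewrite (inj_eq Some_inj); have [<-|ij] := eqVneq i j.
    by rewrite (inj_eq (@lett_inj i)); case: b'.
  by apply: contra ij => /eqP[->].
move=> sv hv v0; suff: exists u, [/\ map pat u = map pat v, alternating u,
    gate false u = u, gate_end false u = f & forall i, ohead u != Some (lett (bc (~~ b) i))].
  by case: b.
move: sv hv v0.
(* Strong induction, since a letter followed by [None] is removed together with it. *)
have [n] := ubnP (size v); elim: n v b => // n IHn [|[[i z]|] v] b //.
  by case: (f) => [_ _ _ /(_ isT)|_ _ _ _] //; exists [::].
rewrite /= ltnS => szv sv _ _; case: v szv sv => [_ _|l v szv /= /andP[_]].
  exists [:: lett (if f then a i else bc b i)].
  by case: (f); split=> //= *; rewrite ?aT ?bcT ?a_bc ?bc_bc.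
rewrite -[path _ l v]/(alternating (l :: v)) => sv.
case: l szv sv => [[j y]|] szv sv.
  have [||u [pu su gu eu hu]] := IHn (lett y :: v) (~~ b) szv sv => //.
  exists (lett (bc b i) :: u).
  rewrite negbK in hu; rewrite /= bcT gu pu ohead_path su andbT; split=> //.
case: v szv sv => [|l v] szv sv.
  exists [:: lett (if f then bc b i else a i); None].
  by case: (f); split=> //= *; rewrite ?aT ?bcT ?a_bc ?bc_bc.
have /andP[l0 slv] : (None != l) && alternating (l :: v) by [].
have [|u [pu su gu eu hu]] := IHn (l :: v) b (ltnW szv) slv _ (fun=> isT).
  by case: (l) l0.
(* a_n brings the gate to [true] and [None] brings it back to [false] before [u] is read. *)
exists (lett (a i) :: None :: u).
rewrite /= aT gu pu ohead_path su andbT; split=> //.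
by move: l0 pu; case: (l) => // q _; case: (u) => [|[]].
Qed.

Lemma alternating_rev (v : seq letter) : alternating (rev v) = alternating v.
Proof. by rewrite rev_sorted; apply: eq_sorted => x y /=; rewrite eq_sym. Qed.

(* Reversing a word exchanges the initial and the final state of the gate. *)
Lemma gate_fixed v : alternating v -> v != [::] ->
  exists u, [/\ map pat u = map pat v \/ map pat u = map pat (rev v),
    alternating u, gate true u = u & gate_end true u = false].
Proof.
move=> sv v0; have [] := eqVneq (ohead v) (Some None) => hv.
  case: v sv v0 hv => // l v sv _ [lN]; subst l.
  move: sv; rewrite /= ohead_path => /andP[hv sv].
  have [//|u [pu su gu eu _]] := gate_fixed_forward (f := false) true sv hv.
  exists (None :: u); rewrite /= gu pu ohead_path su andbT; split=> //; first by left.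
  by move: hv pu; case: v {sv} => [|[]]; case: u {su gu eu} => [|[]].
have [//|u [pu su gu eu _]] := gate_fixed_forward (f := true) true sv hv.
have [g1 g2] := gate_rev false u; rewrite eu gu in g1 g2.
exists (rev u); split=> //; first by right; rewrite !map_rev pu.
by rewrite alternating_rev.
Qed.

(** * Fullness by induction on the length *)

Definition strong_full (v : seq letter) := forall i (x y : cstate i),
  ohead v != Some (lett x) -> ohead v != Some (lett y) ->
  exists h, [/\ dualG h, h v = v, forall l, h (rcons v l) = rcons v l &
                forall z, h [:: lett z] = [:: lett (tperm x y z)]].

(** In state [true] the gate moves b_n and c_n, so neither can begin a fixed word. *)
Lemma toggles_fixed u l : gate true u = u -> ohead u = Some l -> toggles l.
Proof.
case: u => // l' u /= [+ _] [<-]; case: l' => [[i z]|] // /lett_inj /= zz.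
apply: contra_eqT zz; rewrite toggles_lett negbK !inE => /orP[]/eqP ->.
  by rewrite tpermL.
by rewrite tpermR.
Qed.

(* The elements acting trivially on the children of [v] form a normal subgroup
   of the stabilizer of [v]. *)
Lemma full_strong_full v u : (forall i, ~~ odd (k i)) ->
    transitive_on (size v) -> alternating v -> full v ->
    map pat u = map pat v -> alternating u -> gate true u = u ->
    gate_end true u = false ->
  strong_full v.
Proof.
move=> k_even trv sv fullv pu su gu eu i x y hx hy.
have szu : size u = size v by rewrite -(size_map pat) pu size_map.
have [h Hh huv] := trv _ _ szu pu su sv.
have [f hf] := dualG_letter Hh.
pose g := h * gateb true * h^-1.
have Hg : dualG g by apply: dualGM (dualGV Hh); apply: dualGM => //; apply: dualG_gateb.
have gv : g v = v by rewrite -huv bij_conjE /= gu.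
have gvl l : g (rcons v l) = rcons v l.
  have [h' [Hh' h1 _]] := dualG_rev u Hh; have [f' hf'] := dualG_letter Hh'.
  have <- : h (rcons u (lmap (fun i => (f' i)^-1) l)) = rcons v l.
    by rewrite -!cats1 h1 hf' lmapKV huv.
  by rewrite bij_conjE /= -cats1 gate_cat gu eu.
pose p := f i None; pose q := f i (cyc i 0).
have gz z : g [:: lett z] = [:: lett (tperm p q z)].
  have -> : lett z = lmap f (lett ((f i)^-1 z)) by rewrite /lmap /= permKV.
  by rewrite -hf bij_conjE hf -tpermJ conjgE !permM.
have avoid w : ~~ toggles (lett w) -> ohead v != Some (lett (f i w)).
  apply: contraNneq; rewrite -huv (dualG_ohead _ Hh hf).
  case ou: (ohead u) => [l|] //= /Some_inj/(@lmap_inj f _ (lett w)) lw.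
  by apply: (toggles_fixed gu); rewrite ou lw.
have hp : ohead v != Some (lett p) by apply: avoid; rewrite toggles_lett inE eqxx.
have hq : ohead v != Some (lett q) by apply: avoid; rewrite toggles_lett !inE eqxx orbT.
have [->|xy] := eqVneq x y.
  by exists 1; split=> // [|z]; [apply: dualG1 | rewrite tperm1 perm1].
have pq : p != q by rewrite (inj_eq perm_inj).
pose q' := tperm p x q.
have q'x : q' != x by rewrite -(tpermL p x) (inj_eq perm_inj) eq_sym.
have hq' : ohead v != Some (lett q') by rewrite /q'; case: tpermP.
have [s [Hs sv' sz]] := letter_actionM (fullv i p x hp hx) (fullv i q' y hq' hy).
exists (s * g * s^-1); split=> [||l|z].
- by apply: dualGM (dualGV Hs); apply: dualGM.
- by rewrite -{1}sv' bij_conjE gv.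
- have [s' [Hs' s1 _]] := dualG_rev v Hs; have [f' sf'] := dualG_letter Hs'.
  have <- : s (rcons v (lmap (fun i => (f' i)^-1) l)) = rcons v l.
    by rewrite -!cats1 s1 sf' lmapKV sv'.
  by rewrite bij_conjE gvl.
pose t := tperm p x * tperm q' y.
have -> : [:: lett z] = s [:: lett (t^-1 z)] by rewrite sz permKV.
rewrite bij_conjE gz sz; congr [:: lett _].
rewrite -/t -!permM -mulgA -conjgE tpermJ !permM tpermL -/q' tpermL [tperm q' y x]tpermD //.
by rewrite eq_sym.
Qed.

(** If [v] is strongly full, its elements already fix [l]. If [rev v] is, take an element for [v],
    which may move [l], and undo this move from the other end of [v] without affecting first
    letters. *)
Lemma full_rcons v l : (forall i, ~~ odd (k i)) ->
    transitive_on (size v) -> alternating (rcons v l) -> v != [::] ->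
    full v -> full (rev v) ->
  full (rcons v l).
Proof.
move=> k_even trv svl v0 fullv fullrv.
have sv : alternating v.
  by move: svl; rewrite -cats1 => /cat_sorted2[].
have hrv : ohead (rev v) != Some l.
  by move: svl; rewrite -alternating_rev rev_rcons /= ohead_path => /andP[].
have hvl : ohead (rcons v l) = ohead v by case: (v) v0.
have [u [pu su gu eu]] := gate_fixed sv v0.
have [sf|sfr] : strong_full v \/ strong_full (rev v).
- case: pu => pu; [left; apply: full_strong_full pu su gu eu => //|right].
  by apply: full_strong_full pu su gu eu => //; rewrite ?size_rev ?alternating_rev.
- move=> i x y; rewrite hvl => hx hy; have [h [Hh _ hl hz]] := sf i x y hx hy.
  by exists h.
move=> t x y; rewrite hvl => hx hy; have [s [Hs sv' sz]] := fullv t x y hx hy.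
have [s' [Hs' s1 s2]] := dualG_rev v Hs; have [f' sf'] := dualG_letter Hs'.
have s'rv : s' (rev v) = rev v.
  by have := s2 [::]; rewrite !cats0 sv' (size0nil (dualG_size [::] Hs)) cats0.
have svl' : s (rcons v l) = rcons v (lmap f' l) by rewrite -!cats1 s1 sf' sv'.
case: l {svl} hrv hvl svl' => [[i z0]|] hrv hvl svl'; last by exists s.
have hz1 : ohead (rev v) != Some (lmap f' (lett z0)).
  rewrite -s'rv (dualG_ohead _ Hs' sf'); apply: contra hrv.
  by case: (ohead _) => //= l' /eqP/Some_inj/(@lmap_inj f' _ (lett z0)) ->.
have [g [Hg grv grl gz]] := sfr i _ _ hz1 hrv.
have [g' [Hg' g1 g2]] := dualG_rev (rev v) Hg; rewrite revK grv revK in g1 g2.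
have g'l l' : g' [:: l'] = [:: l'].
  by move: (grl l'); rewrite -cats1 g1 => /eqP; rewrite eqseq_cat // eqxx => /eqP.
exists (g' * s); split=> [||z]; first exact: dualGM.
  by rewrite bij_mulE svl' -!cats1 g2 gz tpermL.
by rewrite bij_mulE sz g'l.
Qed.

Lemma dual_full v : injective k -> (forall i, ~~ odd (k i)) ->
  alternating v -> full v.
Proof.
move=> k_inj k_even.
suff H n : transitive_on n /\ forall v, size v = n -> alternating v -> full v.
  by apply: (H (size v)).2.
elim: n => [|n [trn fulln]].
  split=> [u u' /size0nil-> | u /size0nil-> _]; last exact: full_nil.
  by case: u' => // _ _ _; exists 1 => //; apply: dualG1.
split; first exact: transitive_onS.
case/lastP=> // {}v l; rewrite size_rcons => -[szv] svl.
case: (eqVneq v [::]) szv svl => [-> _ _|v0 szv svl]; first exact: full_one.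
have sv : alternating v by move: svl; rewrite -cats1 => /cat_sorted2[].
apply: full_rcons => //; rewrite ?szv //; apply: fulln => //.
  by rewrite size_rev.
by rewrite alternating_rev.
Qed.

(** * The action of letters on binary words *)

Definition next (x : bool) (l : letter) : letter :=
  if x then lmap swp (lmap rot l) else lmap rot l.

(** For a state q, [flip (lett q)] is the Bellaterra transformation of q; [flip None] negates all
    digits. *)
Fixpoint flip (l : letter) (r : seq bool) : seq bool :=
  if r is x :: r' then (x (+) toggles (lmap rot l)) :: flip (next x l) r' else [::].

(** A digit changes only if the rotated letter toggles, and then the next letter does not depend on
    the digit. *)
Lemma flipK l : involutive (flip l).
Proof.
move=> r; elim: r l => //= x r IHr l; rewrite addbK.
suff -> : next (x (+) toggles (lmap rot l)) l = next x l by rewrite IHr.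
rewrite /next; have [t|nt] := boolP (toggles (lmap rot l)); last by rewrite addbF.
by rewrite toggles_fix // !if_same.
Qed.

Definition act (w : seq letter) (r : seq bool) := foldl (fun r l => flip l r) r w.

Lemma act_cons x r w : act w (x :: r) = dual_end x w :: act (dual x w) r.
Proof. by elim: w x r => //= l w IHw x r; rewrite IHw. Qed.

Lemma act_inj w : injective (act w).
Proof. by elim: w => //= l w IHw r r' /IHw/(can_inj (flipK l)). Qed.

Lemma eq_act_dual e u w : act u =1 act w -> act (dual e u) =1 act (dual e w).
Proof. by move=> uw r; have := uw (e :: r); rewrite !act_cons => -[]. Qed.

Lemma dual_order e w : exists n, iter n.+1 (dual e) w = w.
Proof.
have szd (t : (size w).-tuple letter) : size (dual e t) == size w.
  by rewrite dualG_size ?size_tuple //; apply: dualG_dual.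
pose f t := Tuple (szd t).
have f_inj : injective f.
  move=> t t' /(congr1 val) /= tt'; apply: val_inj.
  by apply: (can_inj (bij_VK (dual e))).
have fE n t : val (iter n f t) = iter n (dual e) (val t) by elim: n => //= n ->.
exists (order f (in_tuple w)).-1; rewrite prednK ?order_gt0 //.
by rewrite -(fE _ (in_tuple w)) iter_order.
Qed.

(** Comparing images of words with first digit [e] shows that [dual e] preserves relations. For the
    converse, [dual e] has finite order on words of given length, so further applications lead
    back. *)
Lemma eq_act_dualG h u w : dualG h ->
  act u =1 act w <-> act (h u) =1 act (h w).
Proof.
move=> Hh; move: h Hh u w; apply: dualG_ind => [|g h IHg IHh|g IHg|e] u w //.
- by rewrite !bij_mulE -IHg -IHh.
- by rewrite [X in _ <-> X]IHg !bij_KV.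
split; first exact: eq_act_dual.
have iterE n u' w' : act u' =1 act w' -> act (iter n (dual e) u') =1 act (iter n (dual e) w').
  by move=> uw; elim: n => //= n IHn; apply: eq_act_dual.
have iterM n m v : iter n.+1 (dual e) v = v -> iter (m * n.+1)%N (dual e) v = v.
  by move=> nv; elim: m => // m IHm; rewrite mulSn iterD IHm.
have [nu un] := dual_order e u; have [nw wn] := dual_order e w.
move=> /(iterE (nu.+1 * nw.+1)%N.-1); rewrite -!iterSr !prednK //.
by rewrite mulnC iterM // mulnC iterM.
Qed.

Lemma eq_act_letter i (x y : cstate i) : act [:: lett x] =1 act [:: lett y] -> x = y.
Proof.
move=> xy; apply/eqP/negPn/negP => x_y.
have nil (x' y' : cstate i) : letter_action [::] (tperm x' y') by apply: full_nil.
pose y' := tperm x None y.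
have y'N : y' != None by rewrite -(tpermL x None) (inj_eq perm_inj) eq_sym.
(* This element takes [x] to b and [y] to c, which differ already on the first digit. *)
have [h [Hh _ hz]] := letter_actionM (nil x None) (nil y' (cyc i 0)).
have := (eq_act_dualG [:: lett x] [:: lett y] Hh).1 xy.
rewrite !hz !permM tpermL -/y' tpermL tpermD // => /(_ [:: false]) /=.
rewrite rot_cyc !toggles_lett rotNone !inE eqxx /= eq_cyc mod0n.
by rewrite modn_small.
Qed.

Lemma flip_None r : flip None r = map negb r.
Proof. by elim: r => //= x r IHr; rewrite /next /= if_same IHr addbT. Qed.

Lemma other_letter i (z : cstate i) (l : option letter) :
  exists2 y, y != z & l != Some (lett y).
Proof.
pose y m := tperm None z (cyc i m).
have yz m : y m != z by rewrite -(tpermL None z) (inj_eq perm_inj).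
have [->|ly] := eqVneq l (Some (lett (y 0))); last by exists (y 0).
exists (y (k i).+1); rewrite // (inj_eq Some_inj) (inj_eq (@lett_inj i)).
by rewrite (inj_eq perm_inj) eq_sym cyc_last_neq0.
Qed.

Lemma act_alternating (w : seq letter) : injective k -> (forall i, ~~ odd (k i)) ->
  alternating w -> act w =1 id -> w = [::].
Proof.
move=> k_inj k_even sw w1.
(* The stabilizer of [v] moves [z] to another letter [y], so the relation also holds with [y] in
   place of [z]; cancelling [t] identifies the two letters. The tail [[:: None]] handles relations
   that begin with the flip. *)
have no_letter i (z : cstate i) v t : alternating v -> ohead v != Some (lett z) ->
    t = [::] \/ t = [:: None] -> ~ act v =1 act (lett z :: t).
  move=> sv hz tE vz; have [y yz hy] := other_letter z (ohead v).
  have [h [Hh hv hl]] := dual_full k_inj k_even sv hz hy.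
  have ht : h (lett z :: t) = lett y :: t.
    have [h' [Hh' h1 _]] := dualG_rev [:: lett z] Hh; have [f hf] := dualG_letter Hh'.
    rewrite -cat1s h1 hl tpermL; congr cat.
    by case: tE => ->; rewrite ?hf // (size0nil (dualG_size [::] Hh')).
  have := (eq_act_dualG _ _ Hh).1 vz; rewrite hv ht => vy.
  have /eqP[] := yz; apply: eq_act_letter => r; apply: (@act_inj t).
  by have := vy r; rewrite vz.
case: w sw w1 => // -[[i z]|] v sv w1.
  move: (sv); rewrite /= ohead_path => /andP[hv sv'].
  case: (no_letter i z v [::] sv' hv); first by left.
  by move=> r; have := w1 (flip (lett z) r); rewrite /= flipK.
case: v sv w1 => [|[[i z]|] v] sv w1 //; first by have := w1 [:: false].
move: (sv); rewrite /= ohead_path => /andP[hv sv'].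
case: (no_letter i z v [:: None] sv' hv); first by right.
by move=> r; have := w1 (flip None (flip (lett z) r)); rewrite /= !flipK.
Qed.

Definition letterb l : bijection (seq bool) := Bijection (flipK l) (flipK l).

Lemma prod_letterb w r : (\prod_(l <- w) letterb l) r = act (rev w) r.
Proof.
elim: w r => [|l w IHw] r; first by rewrite big_nil.
by rewrite big_cons bij_mulE IHw rev_cons /act -cats1 foldl_cat.
Qed.

End DualAutomaton.

(** * Free products of groups of order 2 *)

Section FreeProducts.
Local Open Scope group_scope.
Variable gT : groupType.

(** The [s j] generate a free product of groups of order 2: alternating words are its normal
    forms. *)
Definition free_involutions (J : eqType) (s : J -> gT) :=
  (forall j, s j * s j = 1) /\
  forall w, alternating w -> \prod_(j <- w) s j = 1 -> w = [::].

Lemma free_involutions_inj (J J' : eqType) (f : J' -> J) (s : J -> gT) :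
  injective f -> free_involutions s -> free_involutions (s \o f).
Proof.
move=> f_inj [s2 s1]; split=> [j|w sw]; first exact: s2.
move=> w1; suff: map f w = [::] by case: (w).
apply: s1; last by rewrite big_map.
by rewrite sorted_map; move: sw; apply: sub_sorted => x y /=; rewrite inj_eq.
Qed.

Lemma invg_involution (J : eqType) (s : J -> gT) j : free_involutions s -> (s j)^-1 = s j.
Proof. by move=> [s2 _]; apply: (mulgI (s j)); rewrite s2 mulgV. Qed.

Lemma prod_involutions_rev (J : eqType) (s : J -> gT) w : free_involutions s ->
  \prod_(j <- rev w) s j = (\prod_(j <- w) s j)^-1.
Proof.
move=> sf; elim: w => [|j w IHw]; first by rewrite !big_nil invg1.
rewrite rev_cons -cats1 big_cat big_seq1 big_cons invgM IHw.
by rewrite (invg_involution j sf).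
Qed.

Lemma prod_involutions_alternating (J : eqType) (s : J -> gT) w :
  free_involutions s -> exists w', [/\ alternating w',
    \prod_(j <- w') s j = \prod_(j <- w) s j & odd (size w') = odd (size w)].
Proof.
move=> [s2 _]; elim: w => [|j w [w' [sw' pw' ow']]]; first by exists [::].
case: w' sw' pw' ow' => [|j' w'] sw' pw' ow'.
  by exists [:: j]; rewrite /= -ow' big_seq1 big_cons -pw' big_nil mulg1.
have [jj'|jj'] := eqVneq j j'; last first.
  by exists [:: j, j' & w']; rewrite /= jj' -ow' [LHS]big_cons pw' [RHS]big_cons.
exists w'; split; first exact: path_sorted sw'.
  by rewrite [RHS]big_cons -pw' big_cons -jj' mulgA s2 mul1g.
by rewrite /= -ow' /= negbK.
Qed.

(** * Free families and free bases *)

Section FreeFamily.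
Variables (k : nat) (s : 'I_k -> gT).
Hypothesis s_free : forall w, reduced w -> word_value s w = 1 -> w = [::].
Local Notation letter_value u := (if u.2 then s u.1 else (s u.1)^-1).

Lemma word_value_cons u w : word_value s (u :: w) = letter_value u * word_value s w.
Proof. exact: big_cons. Qed.

Lemma word_value_cat w w' :
  word_value s (w ++ w') = word_value s w * word_value s w'.
Proof. exact: big_cat. Qed.

Lemma letter_valueV (u : 'I_k * bool) :
  letter_value (u.1, ~~ u.2) = (letter_value u)^-1.
Proof. by case: u => i [] /=; rewrite ?invgK. Qed.

Definition word_inv (w : seq ('I_k * bool)) := rev (map (fun u => (u.1, ~~ u.2)) w).

Lemma word_value_inv w : word_value s (word_inv w) = (word_value s w)^-1.
Proof.
elim: w => [|u w IHw]; first by rewrite /word_value !big_nil invg1.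
rewrite word_value_cons invgM -IHw -letter_valueV /word_inv map_cons rev_cons -cats1.
by rewrite word_value_cat /word_value big_seq1.
Qed.

Lemma word_value_reduced w : exists2 w', reduced w' & word_value s w' = word_value s w.
Proof.
elim: w => [|u w [w' rw' vw']]; first by exists [::].
case: w' rw' vw' => [|v w'] rw' vw'.
  by exists [:: u] => //; rewrite !word_value_cons vw'.
have [uv|uv] := eqVneq v (u.1, ~~ u.2).
  exists w'; first exact: path_sorted rw'.
  by rewrite word_value_cons -vw' word_value_cons uv letter_valueV mulKVg.
by exists [:: u, v & w']; rewrite /reduced /= ?uv // !word_value_cons -vw' word_value_cons.
Qed.

Lemma reduced_inv w : reduced (word_inv w) = reduced w.
Proof.
rewrite /reduced rev_sorted sorted_map; apply: eq_sorted => -[i b] [j c] /=.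
by rewrite !xpair_eqE (eq_sym i); case: b; case: c.
Qed.

Lemma word_value_inj w w' : reduced w -> reduced w' ->
  word_value s w = word_value s w' -> w = w'.
Proof.
elim: w w' => [|u w IHw] [|u' w'] // rw rw' vv.
- by rewrite (s_free rw') // -vv /word_value big_nil.
- by rewrite (s_free rw) // vv /word_value big_nil.
have [uu'|uu'] := eqVneq u u'.
  move: vv; rewrite -uu' !word_value_cons => /mulgI vv.
  by rewrite (IHw w') // ; [apply: path_sorted rw | apply: path_sorted rw'].
(* With different first letters nothing cancels at the junction, so this nonempty word is reduced
   but has value 1. *)
suff: word_inv (u :: w) ++ u' :: w' = [::] by case: (word_inv _).
apply: s_free; last first.
  by rewrite word_value_cat word_value_inv vv mulVg.
have: reduced (word_inv (u :: w)) by rewrite reduced_inv.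
rewrite /word_inv map_cons rev_cons -cats1 -catA /reduced.
have nuu' : u' != (u.1, ~~ ~~ u.2) by rewrite negbK -surjective_pairing eq_sym.
case: (rev _) => [|v t] /=; first by rewrite nuu'.
by rewrite !cat_path /= => /andP[-> /andP[-> _]]; rewrite nuu'.
Qed.

Lemma free_basis_generated : free_basis s (generated [set x | exists i, x = s i]).
Proof.
split=> [i|x]; first by apply: sub_gen_smallest; exists i.
suff : generated [set x | exists i, x = s i] `<=` [set x | exists w, word_value s w = x].
  move=> /[apply] -[w <-]; have [w' rw' <-] := word_value_reduced w.
  exists w'; split=> // w'' [rw'' vw'']; exact: word_value_inj.
apply: generated_ind => [|_ [i ->]]; last first.
  by exists [:: (i, true)]; rewrite /word_value big_seq1.
split; first by exists [::]; rewrite /word_value big_nil.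
- by move=> _ _ [w <-] [w' <-]; exists (w ++ w'); rewrite word_value_cat.
- by move=> _ [w <-]; exists (word_inv w); rewrite word_value_inv.
Qed.

End FreeFamily.

(** Only an inverse generator followed by a generator cancels, and only the two copies of [s None];
    reducedness makes their neighbours distinct. *)
Lemma free_involutions_reduced k (s : option 'I_k -> gT) w : free_involutions s ->
  reduced w -> word_value (fun j => s None * s (Some j)) w = 1 -> w = [::].
Proof.
move=> sf; have [s2 s1] := sf.
(* The part of each letter that survives any cancellation with what follows. *)
pose pre (u : 'I_k * bool) := if u.2 then [:: None; Some u.1] else [:: Some u.1].
case: w => // u w rw.
suff [t st ->] : exists2 t, alternating (pre u ++ t) &
    word_value (fun j => s None * s (Some j)) (u :: w) = \prod_(j <- pre u ++ t) s j.
  by move=> /(s1 _ st); rewrite /pre; case: (u.2).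
elim: w u rw => [|v w IHw] u rw.
  rewrite /word_value big_seq1 /pre; case: (u.2).
    by exists [::]; rewrite // !big_cons big_nil mulg1.
  by exists [:: None] => //; rewrite invgM !big_cons big_nil mulg1 !(invg_involution _ sf).
have sV j : (s j)^-1 = s j by apply: invg_involution.
have [t st tE] := IHw v (path_sorted rw).
rewrite word_value_cons tE; move: rw st => /= /andP[uv _].
rewrite /pre; case: u uv => i [] /=; case: v {tE} => j [] /= uv st.
- exists ([:: None; Some j] ++ t) => //=.
  by rewrite !big_cons !mulgA.
- exists (Some j :: t); last by rewrite !big_cons !mulgA.
  rewrite /= st andbT; apply: contra uv => /eqP[->]; exact: eqxx.
- exists (Some j :: t); last first.
    by rewrite !big_cons invgM !sV -!mulgA (mulgA (s None) (s None)) s2 mul1g.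
  move: st => /= ->; rewrite andbT; apply: contra uv => /eqP[->]; exact: eqxx.
- exists [:: None, Some j & t]; first by [].
  by rewrite !big_cons invgM !sV !mulgA.
Qed.

(** * Products of an even number of involutions *)

Section EvenSubgroup.
Variables (r : nat) (s : option 'I_r.+1 -> gT).
Hypothesis s_free : free_involutions s.
Local Notation b i := (s (Some i)).
Let A : set gT := generated [set x | exists i, x = s None * b i].
Let B : set gT := generated [set x | exists i, x = b i].
Let E : set gT := generated [set x | exists i, x = b ord0 * b (lift ord0 i)].

Lemma sqr_involution i x : b i * (b i * x) = x.
Proof. by rewrite mulgA (proj1 s_free) mul1g. Qed.

Lemma even_generator i : E (b ord0 * b i).
Proof.
have [E1 _ _] : subgroup E by apply: subgroup_generated.
case: (unliftP ord0 i) => [j|] ->; last by rewrite (proj1 s_free).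
by apply: sub_gen_smallest; exists j.
Qed.

Lemma even_sub : E `<=` A `&` B.
Proof.
have [A1 AM AV] : subgroup A by apply: subgroup_generated.
have [B1 BM BV] : subgroup B by apply: subgroup_generated.
have Ab i : A (s None * b i) by apply: sub_gen_smallest; exists i.
have Bb i : B (b i) by apply: sub_gen_smallest; exists i.
apply: generated_ind => [|_ [i ->]].
  by split=> [|x y [Ax Bx] [Ay By]|x [Ax Bx]]; split; auto.
split; last exact: BM.
have -> : b ord0 * b (lift ord0 i) = (s None * b ord0)^-1 * (s None * b (lift ord0 i)).
  rewrite invgM !(invg_involution _ s_free) -!mulgA (mulgA (s None) (s None)).
  by rewrite (proj1 s_free) mul1g.
by apply: AM; first apply: AV; apply: Ab.
Qed.

Lemma aleshin_words_even x : A x -> exists2 w, ~~ odd (size w) & x = \prod_(j <- w) s j.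
Proof.
move: x; apply: generated_ind => [|_ [i ->]]; last first.
  by exists [:: None; Some i] => //; rewrite !big_cons big_nil mulg1.
split; first by exists [::]; rewrite ?big_nil.
- move=> _ _ [w ow ->] [w' ow' ->]; exists (w ++ w'); last by rewrite big_cat.
  by rewrite size_cat oddD (negPf ow) (negPf ow').
- move=> _ [w ow ->]; exists (rev w); first by rewrite size_rev.
  by rewrite prod_involutions_rev.
Qed.

(** Elements of [A] have even length in the involutions, and reduction preserves parity. *)
Lemma aleshin_not_odd : ~ A (b ord0).
Proof.
move=> /aleshin_words_even [w ow bw].
have [w' [sw' pw' ow']] := prod_involutions_alternating (Some ord0 :: w) s_free.
have w'0 : w' = [::].
  by apply: (proj2 s_free) => //; rewrite pw' big_cons -bw (proj1 s_free).
by move: ow'; rewrite w'0 /= ow.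
Qed.

Lemma even_or_odd x : B x -> E x \/ E (b ord0 * x).
Proof.
have [E1 EM EV] : subgroup E by apply: subgroup_generated.
suff BE : B `<=` [set x | exists w : seq 'I_r.+1, x = \prod_(j <- w) b j].
  move=> /BE[w ->]; elim: w => [|j w IHw]; first by left; rewrite big_nil.
  rewrite big_cons; case: IHw => [Ew|Ew]; [right|left].
    by rewrite mulgA; apply: EM => //; apply: even_generator.
  rewrite -(sqr_involution ord0 (\prod_(_ <- _) _)) mulgA; apply: EM => //.
  have := EV _ (even_generator j).
  by rewrite invgM !(invg_involution _ s_free).
apply: generated_ind => [|_ [i ->]]; last by exists [:: i]; rewrite big_seq1.
split; first by exists [::]; rewrite big_nil.
- by move=> _ _ [w ->] [w' ->]; exists (w ++ w'); rewrite big_cat.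
- move=> _ [w ->]; exists (rev w); rewrite -(big_map Some predT s) -[RHS](big_map Some predT s).
  by rewrite map_rev prod_involutions_rev.
Qed.

Lemma meet_even : A `&` B = E.
Proof.
apply/seteqP; split; last exact: even_sub.
(* In the odd case both [x] and [b ord0 * x] lie in [A], hence so would [b ord0]. *)
move=> x [Ax /even_or_odd[//|Ex]]; case: aleshin_not_odd.
have [_ AM AV] : subgroup A by apply: subgroup_generated.
have [Abx _] := even_sub Ex.
by have := AM _ _ Abx (AV _ Ax); rewrite mulgK.
Qed.

Lemma free_of_rank_aleshin : free_of_rank r.+1 A.
Proof.
split; first exact: subgroup_generated.
exists (fun i => s None * b i); apply: free_basis_generated => w.
exact: free_involutions_reduced.
Qed.

Lemma free_of_rank_meet : free_of_rank r (A `&` B).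
Proof.
rewrite meet_even; split; first exact: subgroup_generated.
(* [b ord0] takes over the role of [s None], which lowers the rank by one. *)
pose f (o : option 'I_r) := if o is Some i then Some (lift ord0 i) else Some ord0.
have f_inj : injective f.
  by move=> [i|] [j|] //= /Some_inj/lift_inj ->.
exists (fun i => b ord0 * b (lift ord0 i)); apply: free_basis_generated => w.
exact: free_involutions_reduced (free_involutions_inj f_inj s_free).
Qed.

Lemma subgroup_of_index2_meet : subgroup_of_index 2 (A `&` B) B.
Proof.
have sE : subgroup E by apply: subgroup_generated.
rewrite meet_even; split=> //; first by rewrite -meet_even => x [].
have [E1 EM EV] := sE; have [B1 BM BV] : subgroup B by apply: subgroup_generated.
have B0 : B (b ord0) by apply: sub_gen_smallest; exists ord0.
pose C := [set b ord0 * h | h in E].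
have notE : ~ E (b ord0) by move=> /even_sub[/aleshin_not_odd].
have -> : left_cosets E B = [set E] `|` [set C].
  apply/seteqP; split=> [_ [g Bg ->]|_ [->|->]] /=.
  - have [Eg|Eg] := even_or_odd Bg; [left|right]; apply/seteqP; split.
    + by move=> _ [h Eh <-]; apply: EM.
    + by move=> x Ex; exists (g^-1 * x); [apply: EM => //; apply: EV|rewrite mulVKg].
    + move=> _ [h Eh <-]; exists (b ord0 * g * h); first exact: EM.
      by rewrite -mulgA sqr_involution.
    + move=> _ [h Eh <-]; exists ((b ord0 * g)^-1 * h); first by apply: EM => //; apply: EV.
      by rewrite invgM (invg_involution _ s_free) -mulgA mulVKg.
  - exists 1 => //; apply/seteqP; split=> [x Ex|_ [x Ex <-]]; last by rewrite mul1g.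
    by exists x; rewrite ?mul1g.
  - by exists (b ord0).
apply/eq_cardSP; exists E; first by left.
suff -> : ([set E] `|` [set C]) `\ E = [set C] by apply: card_set1.
apply/seteqP; split=> [D [[DE|//] nE]|_ ->]; first by case: nE.
split; first by right.
move=> CE; apply: notE; rewrite -[E]CE.
by exists 1; rewrite ?mulg1.
Qed.

End EvenSubgroup.
End FreeProducts.

(** * Groups of the Aleshin and Bellaterra type automata *)

Section AutomatonGroups.
Local Open Scope group_scope.
Variables (I : finType) (n : I -> nat).
Hypotheses (n_gt0 : forall i, (0 < n i)%N) (n_inj : injective n).

Definition cycle_len i := (2 * n i - 2)%N.
Local Notation k := cycle_len.

Lemma cycle_lenE i : k i = (n i).-1.*2.
Proof. by rewrite -mul2n -subn1 mulnBr. Qed.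

Definition encode i (q : aleshin_state (n i)) : cstate k i :=
  match q with
  | st_a => cyc k i (k i).+1
  | st_b => None
  | st_c => cyc k i 0
  | st_q j => cyc k i j.+1
  end.

(** At [m = (k i).+1] the [insub] fails and [q_state] defaults to a_n, the last state of the
    cycle. *)
Lemma encode_q_state i m : (m <= (k i).+1)%N -> encode (q_state (n i) m) = cyc k i m.
Proof.
case: m => // m; rewrite ltnS /q_state => le_m; case: insubP => [j _ <- //|].
by rewrite -leqNgt => ge_m; congr (cyc k i _.+1); apply/eqP; rewrite eqn_leq ge_m.
Qed.

Lemma encode_surj i (z : cstate k i) : exists q, encode q = z.
Proof.
have [->|[m ->]] := cycP z; first by exists st_b.
exists (q_state (n i) (m %% (k i).+2)).
by rewrite encode_q_state ?cyc_modn // -ltnS ltn_mod.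
Qed.

Lemma cyc_gt0 i m : (0 < m < (k i).+2)%N -> cyc k i m \notin [:: None; cyc k i 0].
Proof.
by case/andP=> m_gt0 lt_m; rewrite !inE eq_cyc mod0n modn_small //= -lt0n.
Qed.

Lemma toggles_encode i (q : aleshin_state (n i)) x :
  x (+) toggles (lmap (rot k) (lett (encode q))) = ~~ aleshin_out q x.
Proof.
rewrite /lmap toggles_lett /=; case: q => [|||j] /=.
- by rewrite rot_last !inE eqxx addbF negbK.
- by rewrite rotNone addbF negbK.
- by rewrite rot_cyc cyc_gt0 // addbT.
- by rewrite rot_cyc cyc_gt0 ?addbT //= !ltnS; have := ltn_ord j.
Qed.

Lemma next_encode i (q : aleshin_state (n i)) x :
  next x (lett (encode q)) = lett (encode (aleshin_trans q x)).
Proof.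
have swp_id m : (0 < m < (k i).+2)%N -> swp k i (cyc k i m) = cyc k i m.
  by move/cyc_gt0; rewrite !inE negb_or => /andP[c1 c2]; rewrite tpermD // eq_sym.
rewrite /next /lmap /=; case: q => [|||j] /=.
- by rewrite rot_last; case: x; rewrite //= tpermR.
- by rewrite rotNone; case: x; rewrite //= tpermL.
- by rewrite rot_cyc swp_id // if_same -(@encode_q_state i 1).
- have lt_j := ltn_ord j.
  by rewrite rot_cyc swp_id //= if_same -(@encode_q_state i j.+2).
Qed.

Lemma transf_bellaterra (q : state (disjoint_union (fun i => bellaterra_type (n i)))) r :
  transf q r = flip (lett (encode (tagged q))) r.
Proof. by elim: r q => //= x r IHr q; rewrite IHr toggles_encode next_encode. Qed.

(** Both automata have the same transitions and opposite outputs. *)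
Lemma transf_aleshin (q : state (disjoint_union (fun i => aleshin_type (n i)))) r :
  transf q r = map negb (@transf _ (disjoint_union (fun i => bellaterra_type (n i))) q r).
Proof. by elim: r q => //= x r IHr q; rewrite negbK IHr. Qed.

Lemma automaton_group_union r : #|{: {i : I & cstate k i}}| = r.+1 ->
  let GA := automaton_group (disjoint_union (fun i => aleshin_type (n i))) in
  let GB := automaton_group (disjoint_union (fun i => bellaterra_type (n i))) in
  [/\ free_of_rank r.+1 GA, free_of_rank r (GA `&` GB) &
      subgroup_of_index 2 (GA `&` GB) GB].
Proof.
move=> cardQ GA GB.
pose f (j : 'I_r.+1) : {i : I & cstate k i} := enum_val (cast_ord (esym cardQ) j).
have f_inj : injective f by move=> i j /enum_val_inj/cast_ord_inj.
have f_surj q : exists j, f j = q.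
  by exists (cast_ord cardQ (enum_rank q)); rewrite /f cast_ordK enum_rankK.
pose s (o : option 'I_r.+1) := letterb (omap f o : letter k).
have k_even i : ~~ odd (k i) by rewrite cycle_lenE odd_double.
have k_inj : injective k.
  move=> i j; rewrite !cycle_lenE => /double_inj ij; apply: n_inj.
  by rewrite -(prednK (n_gt0 i)) ij prednK.
have s_free : free_involutions s.
  apply: (free_involutions_inj (inj_omap f_inj) (s := @letterb I k)).
  split=> [l|w sw w1]; first by apply: bijection_eq => r'; apply: flipK.
  suff: rev w = [::] by rewrite -{2}(revK w) => ->.
  apply: (act_alternating k_inj k_even); first by rewrite alternating_rev.
  by move=> r'; rewrite -prod_letterb w1.
have GAE : GA = generated [set x | exists j, x = s None * s (Some j)].
  congr generated; apply/seteqP; split=> [g [q gq]|_ [j ->]].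
    have [j fj] := f_surj (Tagged _ (encode (tagged q))); exists j.
    apply: bijection_eq => r'.
    by rewrite gq transf_aleshin transf_bellaterra bij_mulE /= fj flip_None.
  have [q qj] := encode_surj (tagged (f j)).
  exists (existT (fun i => state (aleshin_type (n i))) (tag (f j)) q); apply/funext => r'.
  rewrite bij_mulE /= flip_None transf_aleshin transf_bellaterra /= qj.
  by rewrite /lett taggedK.
have GBE : GB = generated [set x | exists j, x = s (Some j)].
  congr generated; apply/seteqP; split=> [g [q gq]|_ [j ->]].
    have [j fj] := f_surj (Tagged _ (encode (tagged q))); exists j.
    by apply: bijection_eq => r'; rewrite gq transf_bellaterra /= fj.
  have [q qj] := encode_surj (tagged (f j)).
  exists (existT (fun i => state (bellaterra_type (n i))) (tag (f j)) q); apply/funext => r'.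
  by rewrite transf_bellaterra /= qj /lett taggedK.
rewrite GAE GBE; split.
- exact: free_of_rank_aleshin.
- exact: free_of_rank_meet.
- exact: subgroup_of_index2_meet.
Qed.

End AutomatonGroups.

(** Lets a single automaton be treated as a union over a one-element index set. *)
Lemma automaton_group_union1 (X : finType) (Y : automaton X) :
  automaton_group (disjoint_union (fun _ : 'I_1 => Y)) = automaton_group Y.
Proof.
have transfE (q : state (disjoint_union (fun _ : 'I_1 => Y))) w :
    transf q w = transf (tagged q) w.
  by elim: w q => //= x w IHw q; rewrite IHw.
congr generated; apply/seteqP; split=> g [q gq].
  by exists (tagged q); rewrite gq; apply/funext => w; rewrite transfE.
exists (existT (fun _ : 'I_1 => state Y) ord0 q).
by rewrite gq; apply/funext => w; rewrite transfE.
Qed.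

Lemma automaton_group_single n : (0 < n)%N ->
  let GAB := automaton_group (aleshin_type n) `&`
             automaton_group (bellaterra_type n) in
  free_of_rank (2 * n) GAB /\
  subgroup_of_index 2 GAB (automaton_group (bellaterra_type n)).
Proof.
move=> n_gt0 /=.
have n_inj : injective (fun _ : 'I_1 => n) by move=> i j _; rewrite !ord1.
have cardQ : #|{: {i : 'I_1 & cstate (cycle_len (fun _ : 'I_1 => n)) i}}| = (2 * n).+1.
  rewrite card_tagged sumnE big_map big_enum big_ord1 card_option card_ord.
  by rewrite cycle_lenE; case: (n) n_gt0 => // m _; rewrite mul2n doubleS.
have [_ meet index2] := automaton_group_union (fun=> n_gt0) n_inj cardQ.
by rewrite !automaton_group_union1 in meet index2.
Qed.

Theorem proposition1p12 :
  (let GAB := automaton_group aleshin `&` automaton_group bellaterra in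
   free_of_rank 2 GAB /\
   subgroup_of_index 2 GAB (automaton_group bellaterra)) /\
  (forall n : nat, (0 < n)%N ->
   let GAB := automaton_group (aleshin_type n) `&`
              automaton_group (bellaterra_type n) in
   free_of_rank (2 * n) GAB /\
   subgroup_of_index 2 GAB (automaton_group (bellaterra_type n))) /\
  (forall N : {fset nat}, N <> fset0 -> (forall n, n \in N -> (0 < n)%N) ->
   let GAB := automaton_group (aleshin_union N) `&`
              automaton_group (bellaterra_union N) in
   subgroup_of_index 2 GAB (automaton_group (bellaterra_union N)) /\
   exists r : nat,
     free_of_rank r.+1 (automaton_group (aleshin_union N)) /\
     free_of_rank r GAB).
Proof.
split; first exact: (@automaton_group_single 1).
split; first exact: automaton_group_single.
move=> N N0 N_gt0.
have n_gt0 (n : N) : (0 < val n)%N by apply: N_gt0; apply: valP.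
have [m mN] : exists m, m \in N by apply/fset0Pn/eqP.
(* The number of states is the rank for the Aleshin side; it is positive since a member [m] of [N]
   provides the state b_m. *)
have [r cardQ] : exists r, #|{: {n : N & cstate (cycle_len (fun n : N => val n)) n}}| = r.+1.
  suff : (0 < #|{: {n : N & cstate (cycle_len (fun n : N => val n)) n}}|)%N.
    by case: #|_| => // r _; exists r.
  by apply/card_gt0P; exists (Tagged _ (None : cstate _ [` mN]%fset)).
have [GA GAB index2] := automaton_group_union n_gt0 val_inj cardQ.
by split=> //; exists r.
Qed.
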